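(* Let $k$ be a subfield of $\mathbf{C}$, let $A$ be a locally finite graded set with an operation $[\cdot,\cdot]$ on $\bar A=A\cup\{0\}$ satisfying (S0)–(S3), and let $*$ be the associated quasi-shuffle product on $\mathfrak{A}=k\langle A\rangle$. Then $\mathfrak{A}$ with the multiplication $*$ and the comultiplication $\Delta$ (with counit $\epsilon$) is a bialgebra.
   Context: $A$ is a graded set, $A=\bigsqcup_{n\ge1}A_n$ with each $A_n$ (the elements of degree $n$) finite; elements of $A$ are called letters and $|a|$ is the degree of a letter $a$. $\mathfrak{A}=k\langle A\rangle$ is the $k$-vector space of noncommutative polynomials in the letters, with basis the words (monomials) in the letters, including the empty word $1$. Juxtaposition denotes concatenation. Let $\bar A=A\cup\{0\}$ and let $[\cdot,\cdot]:\bar A\times\bar A\to\bar A$ be a function satisfying: (S0) $[a,0]=0$ for all $a\in\bar A$; (S1) $[a,b]=[b,a]$ for all $a,b\in\bar A$; (S2) $[[a,b],c]=[a,[b,c]]$ for all $a,b,c\in\bar A$; (S3) for all $a,b\in A$, either $[a,b]=0$ or $|[a,b]|=|a|+|b|$. The quasi-shuffle product $*$ is the $k$-bilinear operation on $\mathfrak{A}$ defined recursively on words by $1*w=w*1=w$ and $aw_1*bw_2=a(w_1*bw_2)+b(aw_1*w_2)+[a,b](w_1*w_2)$ for letters $a,b$ and words $w_1,w_2$. The comultiplication $\Delta:\mathfrak{A}\to\mathfrak{A}\otimes\mathfrak{A}$ and counit $\epsilon:\mathfrak{A}\to k$ are the linear maps given on words by $\Delta(w)=\sum_{uv=w}u\otimes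 v$ (sum over all factorizations of $w$ as a concatenation of words $u,v$, possibly empty), $\epsilon(1)=1$, and $\epsilon(w)=0$ for $w\ne1$. *)

(* Defs.v *)
From HB Require Import structures.
From mathcomp Require Import all_boot all_order all_algebra.
From mathcomp Require Import finmap.
From mathcomp Require Import classical_sets cardinality reals.
From mathcomp Require Import complex monalg.

Set Implicit Arguments.
Unset Strict Implicit.
Unset Printing Implicit Defensive.

Import GRing.Theory.

Local Open Scope ring_scope.

Declare Scope tensor_scope.
Delimit Scope tensor_scope with T.

Section LinearExtension.
Variable k : comNzRingType.

Definition malg_lift (K : choiceType) (U : lmodType k) (f : K -> U)
    (x : {malg k[K]}) : U :=
  \sum_(w <- msupp x) x@_w *: f w.

Lemma malg_liftEw (K : choiceType) (U : lmodType k) (f : K -> U)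
    (d : {fset K}) (x : {malg k[K]}) :
  (msupp x `<=` d)%fset -> malg_lift f x = \sum_(w <- d) x@_w *: f w.
Proof.
move=> le_xd; rewrite /malg_lift (big_fset_incl _ le_xd) // => w _ xw.
by rewrite mcoeff_outdom // scale0r.
Qed.

Lemma malg_liftU (K : choiceType) (U : lmodType k) (f : K -> U) (w : K) :
  malg_lift f << w >> = f w.
Proof.
by rewrite /malg_lift msuppU oner_eq0 big_seq_fset1 mcoeffU eqxx mulr1n scale1r.
Qed.

Lemma malg_lift_linear (K : choiceType) (U : lmodType k) (f : K -> U) :
  linear (malg_lift f).
Proof.
move=> c x y; pose d := (msupp x `|` msupp y `|` msupp (c *: x + y))%fset.
rewrite !(@malg_liftEw _ _ _ d) ?fsubsetUr //; last 2 first.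
- by rewrite /d fsubsetU // fsubsetUr.
- by rewrite /d -fsetUA fsubsetUl.
rewrite scaler_sumr -big_split /=; apply: eq_bigr => w _.
by rewrite mcoeffD mcoeffZ scalerDl scalerA.
Qed.

HB.instance Definition _ (K : choiceType) (U : lmodType k) (f : K -> U) :=
  GRing.isLinear.Build k {malg k[K]} U *:%R (malg_lift f) (malg_lift_linear f).

Lemma malg_lift_uniq (K : choiceType) (U : lmodType k)
    (g : {malg k[K]} -> U) :
  linear g -> g =1 malg_lift (fun w => g << w >>).
Proof.
move=> g_lin x.
pose gL := GRing.isLinear.Build k {malg k[K]} U *:%R g g_lin.
pose G : {linear {malg k[K]} -> U} := HB.pack g gL.
rewrite -[g]/(G : _ -> _) {1}[x]monalgE raddf_sum /=.
apply: eq_bigr => w _; rewrite -[RHS]/(x@_w *: G << w >>) -linearZ_LR; congr (G _).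
by apply/malgP => u; rewrite mcoeffZ !mcoeffU mulrnAr mulr1.
Qed.

End LinearExtension.

(* The tensor product of the free modules on K and L is realised as the free  *)
(* module on K * L; malg_tensorP below is its universal property.             *)
Section Tensor.
Variable k : comNzRingType.
Implicit Types K L M : choiceType.

Definition malg_tensor K L (x : {malg k[K]}) (y : {malg k[L]}) :
    {malg k[(K * L)%type]} :=
  malg_lift (fun u => malg_lift (fun v => << (u, v) >>) y) x.

Definition bilinear_op (U V W : lmodType k) (f : U -> V -> W) : Prop :=
  (forall u, linear (f u)) /\ (forall v, linear (fun u => f u v)).

Local Notation "x ⊗ y" := (malg_tensor x y) (at level 40, left associativity).

Definition tensor_map K K' L L' (f : {malg k[K]} -> {malg k[K']})
    (g : {malg k[L]} -> {malg k[L']}) :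
    {malg k[(K * L)%type]} -> {malg k[(K' * L')%type]} :=
  malg_lift (fun p => f << p.1 >> ⊗ g << p.2 >>).

Definition tensor_assoc K L M :
    {malg k[(K * L * M)%type]} -> {malg k[(K * (L * M))%type]} :=
  malg_lift (fun p => << p.1.1 >> ⊗ (<< p.1.2 >> ⊗ << p.2 >>)).

(* k ⊗ V -> V and V ⊗ k -> V composed with phi ⊗ id and id ⊗ phi *)
Definition tensor_contractl K L (phi : {malg k[K]} -> k) :
    {malg k[(K * L)%type]} -> {malg k[L]} :=
  malg_lift (fun p => phi << p.1 >> *: << p.2 >>).

Definition tensor_contractr K L (phi : {malg k[L]} -> k) :
    {malg k[(K * L)%type]} -> {malg k[K]} :=
  malg_lift (fun p => phi << p.2 >> *: << p.1 >>).

Definition tensor_mul K (mul : {malg k[K]} -> {malg k[K]} -> {malg k[K]})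
    (s t : {malg k[(K * K)%type]}) : {malg k[(K * K)%type]} :=
  malg_lift (fun p => malg_lift (fun q =>
    mul << p.1 >> << q.1 >> ⊗ mul << p.2 >> << q.2 >>) t) s.

End Tensor.

Notation "x ⊗ y" := (malg_tensor x y)
  (at level 40, left associativity) : tensor_scope.

Section TensorTheory.
Variable k : comNzRingType.
Implicit Types K L M : choiceType.
Local Open Scope tensor_scope.

Lemma eq_malg_lift K (U : lmodType k) (f g : K -> U) :
  f =1 g -> malg_lift f =1 malg_lift g.
Proof. by move=> fg x; apply: eq_bigr => w _; rewrite fg. Qed.

Lemma malg_lift_bilinear K L (U : lmodType k) (f : K -> L -> U) :
  bilinear_op (fun x y => malg_lift (fun u => malg_lift (f u) y) x).
Proof.
split=> [x c y z|y]; last exact: malg_lift_linear.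
rewrite /malg_lift -/(malg_lift _) scaler_sumr -big_split /=.
apply: eq_bigr => u _.
by rewrite -!/(malg_lift _ _) linearP scalerDr !scalerA mulrC.
Qed.

Lemma malg_tensor_bilinear K L : bilinear_op (@malg_tensor k K L).
Proof. exact: malg_lift_bilinear. Qed.

Lemma malg_tensorUU K L (u : K) (v : L) :
  << u >> ⊗ << v >> = << (u, v) >> :> {malg k[(K * L)%type]}.
Proof. by rewrite /malg_tensor !malg_liftU. Qed.

Lemma bilinear_op_ext K L (U : lmodType k)
    (f g : {malg k[K]} -> {malg k[L]} -> U) :
  bilinear_op f -> bilinear_op g ->
  (forall u v, f << u >> << v >> = g << u >> << v >>) ->
  forall x y, f x y = g x y.
Proof.
move=> [f1 f2] [g1 g2] fg x y.
rewrite (malg_lift_uniq (f2 y)) (malg_lift_uniq (g2 y)).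
apply: eq_malg_lift => u.
rewrite (malg_lift_uniq (f1 _)) (malg_lift_uniq (g1 _)).
exact: eq_malg_lift.
Qed.

Lemma bilinear_op_comp K L (U V : lmodType k)
    (f : {malg k[K]} -> {malg k[L]} -> U) (g : U -> V) :
  bilinear_op f -> linear g -> bilinear_op (fun x y => g (f x y)).
Proof. by move=> [f1 f2] hg; split=> [x c y z|y c x z]; rewrite ?f1 ?f2 hg. Qed.

Theorem malg_tensorP K L (U : lmodType k)
    (f : {malg k[K]} -> {malg k[L]} -> U) :
  bilinear_op f ->
  exists g : {malg k[(K * L)%type]} -> U,
    [/\ linear g, forall x y, g (x ⊗ y) = f x y
      & forall h, linear h -> (forall x y, h (x ⊗ y) = f x y) -> h =1 g].
Proof.
move=> hf; exists (malg_lift (fun p => f << p.1 >> << p.2 >>)); split.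
- exact: malg_lift_linear.
- apply: bilinear_op_ext => // [|u v]; last by rewrite malg_tensorUU malg_liftU.
  by apply: bilinear_op_comp (malg_tensor_bilinear _ _) (malg_lift_linear _).
- move=> h h_lin hE x; rewrite (malg_lift_uniq h_lin).
  by apply: eq_malg_lift => -[u v] /=; rewrite -malg_tensorUU hE.
Qed.

Lemma tensor_mapE K K' L L' (f : {malg k[K]} -> {malg k[K']})
    (g : {malg k[L]} -> {malg k[L']}) x y :
  linear f -> linear g -> tensor_map f g (x ⊗ y) = f x ⊗ g y.
Proof.
move=> hf hg; have [t1 t2] := @malg_tensor_bilinear K' L'.
apply: (bilinear_op_ext (f := fun x y => tensor_map f g (x ⊗ y))
  (g := fun x y => f x ⊗ g y)) => [||u v].
- by apply: bilinear_op_comp (malg_tensor_bilinear _ _) (malg_lift_linear _).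
- by split=> [a c b d|b c a d]; rewrite ?hf ?hg ?t1 ?t2.
- by rewrite malg_tensorUU /tensor_map malg_liftU.
Qed.

Lemma tensor_assocE K L M (x : {malg k[K]}) (y : {malg k[L]})
    (z : {malg k[M]}) :
  tensor_assoc (x ⊗ y ⊗ z) = x ⊗ (y ⊗ z).
Proof.
have lin_assoc : linear (@tensor_assoc k K L M) by exact: malg_lift_linear.
have [a1 a2] := @malg_tensor_bilinear K L.
have [b1 b2] := @malg_tensor_bilinear (K * L)%type M.
have [c1 c2] := @malg_tensor_bilinear K (L * M)%type.
have [d1 d2] := @malg_tensor_bilinear L M.
pose F (z : {malg k[M]}) (x : {malg k[K]}) (y : {malg k[L]}) := tensor_assoc (x ⊗ y ⊗ z).
pose G (z : {malg k[M]}) (x : {malg k[K]}) (y : {malg k[L]}) := x ⊗ (y ⊗ z).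
rewrite -[LHS]/(F z x y) -[RHS]/(G z x y).
apply: (bilinear_op_ext (f := F z) (g := G z)) => [||u v].
- by split=> [a c b d|b c a d]; rewrite /F ?a1 ?a2 b2 lin_assoc.
- by split=> [a c b d|b c a d]; rewrite /G ?d2 ?c1 ?c2.
have linF : linear (fun z => F z << u >> << v >>).
  by move=> c a b; rewrite /F b1 lin_assoc.
have linG : linear (fun z => G z << u >> << v >>).
  by move=> c a b; rewrite /G d1 c1.
rewrite (malg_lift_uniq linF) (malg_lift_uniq linG).
apply: eq_malg_lift => w.
by rewrite /F /G 2![in LHS]malg_tensorUU /tensor_assoc malg_liftU.
Qed.

Lemma tensor_contractlE K L (phi : {malg k[K]} -> k^o) x (y : {malg k[L]}) :
  linear phi -> tensor_contractl phi (x ⊗ y) = phi x *: y.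
Proof.
move=> hphi; apply: (bilinear_op_ext
  (f := fun x y => tensor_contractl phi (x ⊗ y)) (g := fun x y => phi x *: y)).
- by apply: bilinear_op_comp (malg_tensor_bilinear _ _) (malg_lift_linear _).
- split=> [a c b d|b c a d]; first by rewrite scalerDr !scalerA mulrC.
  by rewrite hphi scalerDl scalerA.
- by move=> u v; rewrite malg_tensorUU /tensor_contractl malg_liftU.
Qed.

Lemma tensor_contractrE K L (phi : {malg k[L]} -> k^o) (x : {malg k[K]}) y :
  linear phi -> tensor_contractr phi (x ⊗ y) = phi y *: x.
Proof.
move=> hphi; apply: (bilinear_op_ext
  (f := fun x y => tensor_contractr phi (x ⊗ y)) (g := fun x y => phi y *: x)).
- by apply: bilinear_op_comp (malg_tensor_bilinear _ _) (malg_lift_linear _).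
- split=> [a c b d|b c a d]; last by rewrite scalerDr !scalerA mulrC.
  by rewrite hphi scalerDl scalerA.
- by move=> u v; rewrite malg_tensorUU /tensor_contractr malg_liftU.
Qed.

Lemma tensor_mulE K (mul : {malg k[K]} -> {malg k[K]} -> {malg k[K]})
    x y x' y' :
  bilinear_op mul -> tensor_mul mul (x ⊗ y) (x' ⊗ y') = mul x x' ⊗ mul y y'.
Proof.
move=> [m1 m2]; have [t1 t2] := @malg_tensor_bilinear K K.
have [l1 l2] : bilinear_op (tensor_mul mul) by exact: malg_lift_bilinear.
apply: (bilinear_op_ext (f := fun x y => tensor_mul mul (x ⊗ y) (x' ⊗ y'))
  (g := fun x y => mul x x' ⊗ mul y y')) => [||u v].
- by split=> [a c b d|b c a d]; rewrite ?t1 ?t2 l2.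
- by split=> [a c b d|b c a d]; rewrite m2 ?t1 ?t2.
apply: (bilinear_op_ext
  (f := fun x' y' => tensor_mul mul (<< u >> ⊗ << v >>) (x' ⊗ y'))
  (g := fun x' y' => mul << u >> x' ⊗ mul << v >> y')) => [||u' v'].
- by split=> [a c b d|b c a d]; rewrite ?t1 ?t2 l1.
- by split=> [a c b d|b c a d]; rewrite m1 ?t1 ?t2.
by rewrite !malg_tensorUU /tensor_mul !malg_liftU.
Qed.

End TensorTheory.

Record is_bialgebra (k : comNzRingType) (K : choiceType)
    (mul : {malg k[K]} -> {malg k[K]} -> {malg k[K]}) (one : {malg k[K]})
    (Delta : {malg k[K]} -> {malg k[(K * K)%type]})
    (eps : {malg k[K]} -> k) : Prop :=
  IsBialgebra {
    bialg_mul_bilinear : bilinear_op mul;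
    bialg_mulA : associative mul;
    bialg_mul1x : left_id one mul;
    bialg_mulx1 : right_id one mul;
    bialg_Delta_linear : linear Delta;
    bialg_eps_linear : linear (eps : _ -> k^o);
    bialg_coassoc : forall x,
      tensor_assoc (tensor_map Delta id (Delta x)) =
      tensor_map id Delta (Delta x);
    bialg_counitl : forall x, tensor_contractl eps (Delta x) = x;
    bialg_counitr : forall x, tensor_contractr eps (Delta x) = x;
    bialg_DeltaM : forall x y,
      Delta (mul x y) = tensor_mul mul (Delta x) (Delta y);
    bialg_Delta1 : Delta one = (one ⊗ one)%T;
    bialg_epsM : forall x y, eps (mul x y) = eps x * eps y;
    bialg_eps1 : eps one = 1
  }.

Section GradedLetters.
Variables (A : choiceType) (deg : A -> nat).

Definition locally_finite_grading : Prop :=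
  (forall a, 0 < deg a)%N /\
  (forall n : nat, finite_set [set a | deg a = n]%classic).

(* option A is the set A ∪ {0}, with 0 encoded as None *)
Record is_bracket (br : option A -> option A -> option A) : Prop := IsBracket {
  br0 : forall x, br x None = None;
  brC : forall x y, br x y = br y x;
  brA : forall x y z, br (br x y) z = br x (br y z);
  br_deg : forall a b : A,
    br (Some a) (Some b) = None \/
    exists2 c, br (Some a) (Some b) = Some c & deg c = (deg a + deg b)%N
}.

End GradedLetters.

(* The ring product of {malg k[{fmonom A}]} is concatenation.                 *)
Section QuasiShuffle.
Variables (k : comNzRingType) (A : choiceType).
Local Notation ncpoly := {malg k[{fmonom A}]}.

Definition word (s : seq A) : ncpoly := << FMonom s >>.

Definition letter (x : option A) : ncpoly :=
  if x is Some a then word [:: a] else 0.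

Variable br : option A -> option A -> option A.

Fixpoint qsh_word (w1 : seq A) : seq A -> ncpoly :=
  if w1 is a :: w1' then
    fix qsh_aw1 (w2 : seq A) : ncpoly :=
      if w2 is b :: w2' then
        letter (Some a) * qsh_word w1' w2
        + letter (Some b) * qsh_aw1 w2'
        + letter (br (Some a) (Some b)) * qsh_word w1' w2'
      else word w1
  else fun w2 => word w2.

Definition qsh_mul (x y : ncpoly) : ncpoly :=
  malg_lift (fun u : {fmonom A} =>
    malg_lift (fun v : {fmonom A} => qsh_word u v) y) x.

Definition deconcat : ncpoly -> {malg k[({fmonom A} * {fmonom A})%type]} :=
  malg_lift (fun w : {fmonom A} =>
    \sum_(i < (size w).+1) (word (take i w) ⊗ word (drop i w))%T).

Definition counit : ncpoly -> k :=
  malg_lift (U := k^o) (fun w : {fmonom A} => (w == [::] :> seq A)%:R).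

Lemma word_nil : word [::] = 1.
Proof. by congr << _ >>; apply/eqP; rewrite fmP fm1. Qed.

Lemma word_cat s t : word (s ++ t) = word s * word t.
Proof.
rewrite /word malgM_def fgmulUU mulr1.
by congr << _ >>; apply/eqP; rewrite fmP fmM.
Qed.

Lemma qsh_mul1w w : qsh_mul 1 (word w) = word w.
Proof. by rewrite -word_nil /qsh_mul !malg_liftU. Qed.

Lemma qsh_mulw1 w : qsh_mul (word w) 1 = word w.
Proof. by rewrite -word_nil /qsh_mul !malg_liftU; case: w. Qed.

Lemma qsh_mul_rec a b w1 w2 :
  qsh_mul (letter (Some a) * word w1) (letter (Some b) * word w2) =
    letter (Some a) * qsh_mul (word w1) (letter (Some b) * word w2)
  + letter (Some b) * qsh_mul (letter (Some a) * word w1) (word w2)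
  + letter (br (Some a) (Some b)) * qsh_mul (word w1) (word w2).
Proof. by rewrite /= -!word_cat /qsh_mul !malg_liftU. Qed.

End QuasiShuffle.

Arguments deconcat {k A}.
Arguments counit {k A}.

(* Main.v *)
(* Prepending a letter is a linear operator P_a on words (P_0 = 0), and the
   recursion defining * says
     P_a x * P_b y = P_a (x * P_b y) + P_b (P_a x * y) + P_[a,b] (x * y),
   while deconcatenation satisfies D (P_a x) = 1 ⊗ P_a x + (P_a ⊗ id) (D x).
   Every bialgebra axiom is multilinear, hence need only be checked on words,
   where induction on the lengths applies.  Expanding both sides of
   (P_a x * P_b y) * P_c z = P_a x * (P_b y * P_c z) gives the same seven terms
   by the inductive hypotheses and the associativity of [,]; for
   D (x * y) = D x * D y one uses that P_a ⊗ id satisfies the recursion of * on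
   the tensor square. *)
Require Import Defs.
From mathcomp Require Import all_boot all_order all_algebra.
From mathcomp Require Import reals complex monalg.

Set Implicit Arguments.
Unset Strict Implicit.
Unset Printing Implicit Defensive.

Import GRing.Theory.

Local Open Scope ring_scope.
Local Open Scope tensor_scope.

(** * Calculus of linear maps given as plain functions with a proof of [linear] *)

Section Linear.
Variables (k : comNzRingType) (U V : lmodType k).
Variables (f g : U -> V).
Hypotheses (f_lin : linear f) (g_lin : linear g).

Lemma lin0 : f 0 = 0.
Proof. by have := f_lin (-1) 0 0; rewrite scaler0 addr0 scaleN1r addNr. Qed.

Lemma linD x y : f (x + y) = f x + f y.
Proof. by have := f_lin 1 x y; rewrite !scale1r. Qed.

Lemma linD3 x y z : f (x + y + z) = f x + f y + f z.
Proof. by rewrite !linD. Qed.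

Lemma linZ c x : f (c *: x) = c *: f x.
Proof. by have := f_lin c x 0; rewrite lin0 !addr0. Qed.

Lemma linear_add : linear (fun x => f x + g x).
Proof. by move=> c x y; rewrite f_lin g_lin scalerDr addrACA. Qed.

Lemma linear_comp (W : lmodType k) (h : V -> W) :
  linear h -> linear (fun x => h (f x)).
Proof. by move=> h_lin c x y; rewrite f_lin h_lin. Qed.

End Linear.

Lemma malg_linear_ext (k : comNzRingType) (K : choiceType) (U : lmodType k)
    (f g : {malg k[K]} -> U) :
  linear f -> linear g -> (forall w, f << w >> = g << w >>) -> f =1 g.
Proof.
move=> f_lin g_lin fg x; rewrite (malg_lift_uniq f_lin) (malg_lift_uniq g_lin).
exact: eq_malg_lift.
Qed.

(** * Tensor products: extensionality and maps acting on one factor *)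

Section Tensor.
Variables (k : comNzRingType) (K L : choiceType).

(** Each basis element of the free module on pairs is itself a pure tensor. Testing on all pure
    tensors, and not only on basis pairs, keeps later goals in a shape where the product formulas
    for [⊗] apply. *)
Lemma tensor_linear_ext (U : lmodType k)
    (f g : {malg k[(K * L)%type]} -> U) :
  linear f -> linear g ->
  (forall x y, f (x ⊗ y) = g (x ⊗ y)) -> f =1 g.
Proof.
move=> f_lin g_lin fg; apply: malg_linear_ext => // -[u v].
by rewrite -malg_tensorUU.
Qed.

Lemma tensor_map_linear (K' L' : choiceType)
    (f : {malg k[K]} -> {malg k[K']}) (g : {malg k[L]} -> {malg k[L']}) :
  linear (tensor_map f g).
Proof. exact: malg_lift_linear. Qed.

Lemma tensor_map_idr (K' : choiceType) (f : {malg k[K]} -> {malg k[K']}) :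
  linear f -> forall x (y : {malg k[L]}), tensor_map f id (x ⊗ y) = f x ⊗ y.
Proof.
move=> f_lin x y; have id_lin : linear (@id {malg k[L]}) by [].
exact: (tensor_mapE x y f_lin id_lin).
Qed.

Lemma tensor_map_idl (L' : choiceType) (g : {malg k[L]} -> {malg k[L']}) :
  linear g -> forall (x : {malg k[K]}) y, tensor_map id g (x ⊗ y) = x ⊗ g y.
Proof.
move=> g_lin x y; have id_lin : linear (@id {malg k[K]}) by [].
exact: (tensor_mapE x y id_lin g_lin).
Qed.

Lemma tensor_linear_l (y : {malg k[L]}) :
  linear (fun x : {malg k[K]} => x ⊗ y).
Proof. by have [] := @malg_tensor_bilinear k K L. Qed.

Lemma tensor_linear_r (x : {malg k[K]}) :
  linear (malg_tensor x : {malg k[L]} -> _).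
Proof. by have [] := @malg_tensor_bilinear k K L. Qed.

End Tensor.

(** * Coassociativity for an abstract operator [f] in the role of P_a *)

Section TensorMapAssoc.
Variables (k : comNzRingType) (K : choiceType).
Variables (f : {malg k[K]} -> {malg k[K]}).
Variables (D : {malg k[K]} -> {malg k[(K * K)%type]}) (o : {malg k[K]}).
Hypotheses (f_lin : linear f) (D_lin : linear D).
Implicit Types (L M : choiceType).

Let fl L : linear (tensor_map f (@id {malg k[L]})).
Proof. exact: tensor_map_linear. Qed.

Let Dl L : linear (tensor_map D (@id {malg k[L]})).
Proof. exact: tensor_map_linear. Qed.

Let al L M : linear (@tensor_assoc k K L M).
Proof. exact: malg_lift_linear. Qed.

(** Both sides send x ⊗ y ⊗ z to f x ⊗ (y ⊗ z). Extensionality is used twice, first to split off z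
    and then to split the remaining tensor. *)
Lemma tensor_assoc_map L M (t : {malg k[(K * L * M)%type]}) :
  tensor_assoc (tensor_map (tensor_map f id) id t) =
  tensor_map f id (tensor_assoc t).
Proof.
have ffl : linear (tensor_map (tensor_map f (@id {malg k[L]})) (@id {malg k[M]})).
  exact: tensor_map_linear.
move: t; apply: tensor_linear_ext => [||t z].
- exact: (linear_comp ffl (@al _ _)).
- exact: (linear_comp (@al _ _) (@fl _)).
rewrite (tensor_map_idr (@fl _)); have zl := tensor_linear_l z.
move: t; apply: tensor_linear_ext => [||x y].
- exact: (linear_comp (linear_comp (@fl _) (zl _)) (@al _ _)).
- exact: (linear_comp (linear_comp (zl _) (@al _ _)) (@fl _)).
rewrite (tensor_map_idr f_lin) [LHS]tensor_assocE.
by rewrite [X in tensor_map _ _ X]tensor_assocE [RHS](tensor_map_idr f_lin).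
Qed.

Lemma tensor_map_comm L L' (g : {malg k[L]} -> {malg k[L']}) :
  linear g -> forall t : {malg k[(K * L)%type]},
  tensor_map id g (tensor_map f id t) = tensor_map f id (tensor_map id g t).
Proof.
move=> g_lin; have gl : linear (tensor_map (@id {malg k[K]}) g).
  exact: tensor_map_linear.
apply: tensor_linear_ext => [||x y].
- exact: (linear_comp (@fl _) gl).
- exact: (linear_comp gl (@fl _)).
rewrite (tensor_map_idr f_lin) !(tensor_map_idl g_lin).
by rewrite (tensor_map_idr f_lin).
Qed.

Hypothesis fD : forall x, D (f x) = o ⊗ f x + tensor_map f id (D x).

(** This is [fD] applied in the first factor: on x ⊗ y, the term o ⊗ f x reassociates to o ⊗ (f x ⊗
    y), and in the other term [f] moves outside by [tensor_assoc_map]. *)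
Lemma tensor_assoc_map_coprod L (t : {malg k[(K * L)%type]}) :
  tensor_assoc (tensor_map D id (tensor_map f id t)) =
  o ⊗ tensor_map f id t + tensor_map f id (tensor_assoc (tensor_map D id t)).
Proof.
have ol : linear (malg_tensor o : {malg k[(K * L)%type]} -> _).
  exact: tensor_linear_r.
move: t; apply: tensor_linear_ext => [||x y].
- exact: (linear_comp (@fl _) (linear_comp (@Dl _) (@al _ _))).
- apply: linear_add; first exact: (linear_comp (@fl _) ol).
  exact: (linear_comp (@Dl _) (linear_comp (@al _ _) (@fl _))).
rewrite (tensor_map_idr f_lin) !(tensor_map_idr D_lin) fD.
rewrite (linD (tensor_linear_l y)) [LHS](linD (@al _ _)).
congr (_ + _); first exact: tensor_assocE.
rewrite -[RHS]tensor_assoc_map.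
by rewrite [X in _ = tensor_assoc X](tensor_map_idr (@fl _)).
Qed.

(** Up to reassociation, both sides expand to o ⊗ (o ⊗ f x) + o ⊗ (f ⊗ id)(D x) plus f ⊗ id applied
    to one side of coassociativity at x. On the right this last term arises because id ⊗ D commutes
    with f ⊗ id. *)
Lemma coassoc_step x : D o = o ⊗ o ->
  tensor_assoc (tensor_map D id (D x)) = tensor_map id D (D x) ->
  tensor_assoc (tensor_map D id (D (f x))) = tensor_map id D (D (f x)).
Proof.
move=> Do coassoc_x; have Dr : linear (tensor_map (@id {malg k[K]}) D).
  exact: tensor_map_linear.
rewrite fD (linD (@Dl _)) (linD Dr) [LHS](linD (@al _ _)).
rewrite [X in _ + X = _]tensor_assoc_map_coprod coassoc_x.
rewrite [X in _ = _ + X](tensor_map_comm D_lin) [LHS]addrA; congr (_ + _).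
rewrite (tensor_map_idr D_lin) (tensor_map_idl D_lin) Do fD.
rewrite [RHS](linD (tensor_linear_r o)); congr (_ + _); exact: tensor_assocE.
Qed.

End TensorMapAssoc.

(** * Words, the operators P_a, and the coalgebra structure *)

Section QuasiShuffle.
Variables (k : comNzRingType) (A : choiceType).
Local Notation ncpoly := {malg k[{fmonom A}]}.

Lemma word_linear_ext (U : lmodType k) (f g : ncpoly -> U) :
  linear f -> linear g -> (forall s, f (word k s) = g (word k s)) -> f =1 g.
Proof. by move=> hf hg fg; apply: malg_linear_ext => // -[s]; apply: fg. Qed.

(** This is P_a. Indexing by [option A] allows [prepend (br a b)] without a case distinction on
    whether the bracket vanishes. *)
Definition prepend (a : option A) (x : ncpoly) : ncpoly := letter k a * x.

Lemma prepend_word a s : prepend (Some a) (word k s) = word k (a :: s).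
Proof. by rewrite /prepend /= -word_cat. Qed.

Lemma prepend_None x : prepend None x = 0.
Proof. exact: mul0r. Qed.

(** For a genuine letter, left concatenation is the linear extension of the map v ↦ av on words, so
    linearity is inherited from [malg_lift]. *)
Lemma prepend_linear a : linear (prepend a).
Proof.
case: a => [a|] c x y; last by rewrite !prepend_None scaler0 addr0.
suff E : prepend (Some a) =1 malg_lift (fun v : {fmonom A} => word k (a :: v)).
  by rewrite !E malg_lift_linear.
move=> z; rewrite /prepend malgM_def fgmulUg; apply: eq_bigr => -[s] _.
apply/malgP => u; rewrite mcoeffZ !mcoeffU mulrnAr mulr1 mul1r.
by congr (_ *+ (_ == _)); apply/eqP; rewrite fmP fmM.
Qed.

Lemma word_bilinear_ext (U : lmodType k) (f g : ncpoly -> ncpoly -> U) :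
  bilinear_op f -> bilinear_op g ->
  (forall s t, f (word k s) (word k t) = g (word k s) (word k t)) ->
  forall x y, f x y = g x y.
Proof.
by move=> hf hg fg; apply: bilinear_op_ext => // -[s] [t]; apply: fg.
Qed.

Local Notation tprepend a :=
  (tensor_map (prepend a) (id : ncpoly -> ncpoly)).

Lemma tprependE a (x y : ncpoly) : tprepend a (x ⊗ y) = prepend a x ⊗ y.
Proof. exact: (tensor_map_idr (@prepend_linear a)). Qed.

Lemma deconcat_linear : linear (@deconcat k A).
Proof. exact: malg_lift_linear. Qed.

Lemma counit_linear : linear (@counit k A : ncpoly -> k^o).
Proof. exact: malg_lift_linear. Qed.

Lemma deconcat1 : deconcat (1 : ncpoly) = 1 ⊗ 1.
Proof.
by rewrite -word_nil /deconcat malg_liftU /= big_ord_recl big_ord0 addr0.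
Qed.

Lemma counit1 : counit (1 : ncpoly) = 1.
Proof. by rewrite -word_nil /counit malg_liftU. Qed.

(** A factorization uv of the word as has either u empty, giving 1 ⊗ as, or u = au' with u'v = s,
    giving P_a ⊗ id on a term of the coproduct of s. The case a = 0 is included because a bracket
    may take that value. *)
Lemma deconcat_prepend a (x : ncpoly) :
  deconcat (prepend a x) = 1 ⊗ prepend a x + tprepend a (deconcat x).
Proof.
have dl := deconcat_linear; have pl := @prepend_linear a.
have tl : linear (tprepend a) by exact: tensor_map_linear.
have t1 : linear (malg_tensor (1 : ncpoly) : ncpoly -> _).
  exact: tensor_linear_r.
pose f (x : ncpoly) := deconcat (prepend a x).
pose g (x : ncpoly) := 1 ⊗ prepend a x + tprepend a (deconcat x).
apply: (word_linear_ext (f := f) (g := g)) => [||s]; rewrite /f /g.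
- exact: (linear_comp pl dl).
- exact: (linear_add (linear_comp pl t1) (linear_comp dl tl)).
case: a dl pl tl {f g} => [a|] dl pl tl.
(* The index 0 of the sum is the cut with empty prefix; the remaining cuts are those of [s], shifted
   by one. *)
- rewrite prepend_word /deconcat !malg_liftU /= big_ord_recl /=.
  rewrite word_nil; congr (_ + _).
  rewrite (big_morph _ (linD tl) (lin0 tl)); apply: eq_bigr => i _.
  by rewrite tprependE prepend_word.
rewrite prepend_None (lin0 dl) (lin0 t1) add0r.
(* For a = 0 the left side and the first term are already zero; it remains to see that P_0 ⊗ id
   vanishes. *)
suff E : (tprepend None) =1 (fun=> 0) by rewrite E.
apply: tensor_linear_ext => // [|x' y].
  by move=> c u v; rewrite scaler0 addr0.
by rewrite tprependE prepend_None (lin0 (tensor_linear_l y)).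
Qed.

Lemma counit_prepend a (x : ncpoly) : counit (prepend a x) = 0.
Proof.
case: a => [a|]; last by rewrite prepend_None (lin0 counit_linear).
apply: (word_linear_ext (f := fun x => counit (prepend (Some a) x) : k^o)
  (g := fun=> 0)) => [||s].
- exact: (linear_comp (@prepend_linear _) counit_linear).
- by move=> c u v; rewrite scaler0 addr0.
by rewrite prepend_word /counit malg_liftU.
Qed.

(** Induction on words phrased through P_a, so that the coalgebra axioms can be proved from
    [deconcat_prepend] without returning to sums over cuts. *)
Lemma word_prepend_ind (P : ncpoly -> Prop) :
  P 1 -> (forall a x, P x -> P (prepend (Some a) x)) ->
  forall s, P (word k s).
Proof.
move=> P1 Pa; elim=> [|a s IHs]; first by rewrite word_nil.
by rewrite -prepend_word; apply: Pa.
Qed.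

Lemma deconcat_coassoc (x : ncpoly) :
  tensor_assoc (tensor_map deconcat id (deconcat x)) =
  tensor_map id deconcat (deconcat x).
Proof.
have dl := deconcat_linear.
have al : linear (@tensor_assoc k {fmonom A} {fmonom A} {fmonom A}).
  exact: malg_lift_linear.
have ml1 : linear (tensor_map (@deconcat k A) (id : ncpoly -> ncpoly)).
  exact: tensor_map_linear.
have ml2 : linear (tensor_map (id : ncpoly -> ncpoly) (@deconcat k A)).
  exact: tensor_map_linear.
apply: (word_linear_ext
  (f := fun x => tensor_assoc (tensor_map deconcat id (deconcat x)))
  (g := fun x => tensor_map id deconcat (deconcat x))) => [||s].
- exact: (linear_comp dl (linear_comp ml1 al)).
- exact: (linear_comp dl ml2).
elim/word_prepend_ind: (word k s) => {s x} [|a x IHx].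
  rewrite deconcat1 (tensor_map_idr dl) (tensor_map_idl dl) deconcat1.
  exact: tensor_assocE.
exact: (coassoc_step (@prepend_linear (Some a)) dl
  (deconcat_prepend (Some a)) deconcat1 IHx).
Qed.

(** In the coproduct of P_a x, the term 1 ⊗ P_a x already contracts to P_a x. The other term has
    first factors of the form P_a u, which the counit kills, so a case distinction suffices. *)
Lemma deconcat_counitl (x : ncpoly) : tensor_contractl counit (deconcat x) = x.
Proof.
have dl := deconcat_linear; have el := counit_linear.
have cl : linear (tensor_contractl (@counit k A) : _ -> ncpoly).
  exact: malg_lift_linear.
apply: (word_linear_ext (f := fun x => tensor_contractl counit (deconcat x))
  (g := id)) => [|//|s]; first exact: (linear_comp dl cl).
elim/word_prepend_ind: (word k s) => {s x} [|a x _].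
  by rewrite deconcat1 (tensor_contractlE _ _ el) counit1 scale1r.
rewrite deconcat_prepend (linD cl) (tensor_contractlE _ _ el) counit1 scale1r.
suff E : (fun t => tensor_contractl counit (tprepend (Some a) t)) =1 (fun=> 0).
  by rewrite E addr0.
have tpl : linear (tprepend (Some a)) by exact: tensor_map_linear.
apply: tensor_linear_ext => [||u v].
- exact: (linear_comp tpl cl).
- by move=> c u v; rewrite scaler0 addr0.
by rewrite tprependE (tensor_contractlE _ _ el) counit_prepend scale0r.
Qed.

(** Here the roles are exchanged: the counit kills 1 ⊗ P_a x, while contraction on the right
    commutes with P_a, so the other term yields P_a x by induction. *)
Lemma deconcat_counitr (x : ncpoly) : tensor_contractr counit (deconcat x) = x.
Proof.
have dl := deconcat_linear; have el := counit_linear.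
have cl : linear (tensor_contractr (@counit k A) : _ -> ncpoly).
  exact: malg_lift_linear.
apply: (word_linear_ext (f := fun x => tensor_contractr counit (deconcat x))
  (g := id)) => [|//|s]; first exact: (linear_comp dl cl).
elim/word_prepend_ind: (word k s) => {s x} [|a x IHx].
  by rewrite deconcat1 (tensor_contractrE _ _ el) counit1 scale1r.
rewrite deconcat_prepend (linD cl) (tensor_contractrE _ _ el) counit_prepend.
rewrite scale0r add0r -[in RHS]IHx; move: (deconcat x).
have tpl : linear (tprepend (Some a)) by exact: tensor_map_linear.
have pl := @prepend_linear (Some a).
apply: tensor_linear_ext => [||u v].
- exact: (linear_comp tpl cl).
- exact: (linear_comp cl pl).
rewrite tprependE [LHS](tensor_contractrE _ _ el).
by rewrite [X in _ = prepend _ X](tensor_contractrE _ _ el) (linZ pl).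
Qed.

(** * The quasi-shuffle product: recursion, unit and associativity *)

Section Product.
Variables (br : option A -> option A -> option A).
Hypothesis br0 : forall a, br a None = None.
Hypothesis brC : commutative br.
Hypothesis brA : associative br.

Local Notation "x ∘ y" := (qsh_mul br x y : ncpoly) (at level 40).

Lemma qsh_bilinear : bilinear_op (qsh_mul br : ncpoly -> ncpoly -> ncpoly).
Proof. exact: malg_lift_bilinear. Qed.

Lemma qsh_linear_r (x : ncpoly) : linear (qsh_mul br x).
Proof. by case: qsh_bilinear. Qed.

Lemma qsh_linear_l (y : ncpoly) : linear (fun x => x ∘ y).
Proof. by case: qsh_bilinear. Qed.

Lemma qsh_mul1x : left_id (1 : ncpoly) (qsh_mul br).
Proof.
apply: word_linear_ext => // [|s]; [exact: qsh_linear_r | exact: qsh_mul1w].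
Qed.

Lemma qsh_mulx1 : right_id (1 : ncpoly) (qsh_mul br).
Proof.
apply: (word_linear_ext (f := fun x => x ∘ 1) (g := id)) => // [|s].
- exact: qsh_linear_l.
- exact: qsh_mulw1.
Qed.

(** The defining recursion, extended bilinearly from words to polynomials and from letters to 0. If
    a or b is 0, each term vanishes, the bracket term by [br0] and [brC]. *)
Lemma qsh_prepend a b (x y : ncpoly) :
  prepend a x ∘ prepend b y =
    prepend a (x ∘ prepend b y) + prepend b (prepend a x ∘ y)
    + prepend (br a b) (x ∘ y).
Proof.
case: a => [a|]; last first.
  have p0 u v : prepend None u ∘ v = 0.
    by rewrite prepend_None; apply: (lin0 (qsh_linear_l v)).
  rewrite brC br0 [LHS]p0 [X in _ = X + _ + _]prepend_None.
  rewrite [X in _ = _ + prepend _ X + _]p0 [X in _ = _ + _ + X]prepend_None.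
  by rewrite (lin0 (prepend_linear b)) !addr0.
case: b => [b|]; last first.
  have p0 u v : v ∘ prepend None u = 0.
    by rewrite prepend_None; apply: (lin0 (qsh_linear_r v)).
  rewrite br0 [LHS]p0 [X in _ = prepend _ X + _ + _]p0.
  rewrite [X in _ = _ + X + _]prepend_None [X in _ = _ + _ + X]prepend_None.
  by rewrite (lin0 (prepend_linear (Some a))) !addr0.
pose f (x y : ncpoly) := prepend (Some a) x ∘ prepend (Some b) y.
pose g (x y : ncpoly) := prepend (Some a) (x ∘ prepend (Some b) y)
  + prepend (Some b) (prepend (Some a) x ∘ y)
  + prepend (br (Some a) (Some b)) (x ∘ y).
have pl := prepend_linear; have ql := qsh_linear_l; have qr := qsh_linear_r.
apply: (word_bilinear_ext (f := f) (g := g)) => [||s t].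
- split=> z; first exact: (linear_comp (pl _) (qr _)).
  exact: (linear_comp (pl _) (ql _)).
- split=> z; apply: linear_add; first 1 [apply: linear_add].
  + exact: (linear_comp (linear_comp (pl _) (qr _)) (pl _)).
  + exact: (linear_comp (qr _) (pl _)).
  + exact: (linear_comp (qr _) (pl _)).
  + apply: linear_add.
    * exact: (linear_comp (ql _) (pl _)).
    * exact: (linear_comp (linear_comp (pl _) (ql _)) (pl _)).
  + exact: (linear_comp (ql _) (pl _)).
exact: qsh_mul_rec.
Qed.

(** The inductive step of associativity. The seven associativity hypotheses are the ways to remove
    the first letter from at least one factor. [X], [Y], [Z] are tied to P_a x, P_b y, P_c z by
    equations so that words can be substituted for them directly. *)
Lemma qsh_mulA_prepend a b c (x y z X Y Z : ncpoly) :
  prepend a x = X -> prepend b y = Y -> prepend c z = Z ->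
  x ∘ (Y ∘ Z) = (x ∘ Y) ∘ Z -> X ∘ (y ∘ Z) = (X ∘ y) ∘ Z ->
  X ∘ (Y ∘ z) = (X ∘ Y) ∘ z -> x ∘ (y ∘ Z) = (x ∘ y) ∘ Z ->
  x ∘ (Y ∘ z) = (x ∘ Y) ∘ z -> X ∘ (y ∘ z) = (X ∘ y) ∘ z ->
  x ∘ (y ∘ z) = (x ∘ y) ∘ z ->
  X ∘ (Y ∘ Z) = (X ∘ Y) ∘ Z.
Proof.
move=> <- <- <- {X Y Z}; set X := prepend a x; set Y := prepend b y.
set Z := prepend c z => xYZ XyZ XYz xyZ xYz Xyz xyz.
have pl := prepend_linear; have ql := qsh_linear_l; have qr := qsh_linear_r.
have sum9 (V : zmodType) (u1 u2 u3 a1 a2 a3 b1 b2 b3 c1 c2 c3 : V) :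
    u1 = a1 + b1 + c1 -> u2 = a2 + b2 + c2 -> u3 = a3 + b3 + c3 ->
    u1 + u2 + u3 = a1 + a2 + a3 + (b1 + b2 + b3) + (c1 + c2 + c3).
  by move=> -> -> ->; rewrite (AC (3*3*3) ((1*4*7)*(2*5*8)*(3*6*9))).
have YZ := qsh_prepend b c y z; have XY := qsh_prepend a b x y.
(* Expanding Y ∘ Z and then each product with X gives nine terms; the three that begin with P_a fold
   back into the single term P_a (x ∘ (Y ∘ Z)). *)
have lhsE : X ∘ (Y ∘ Z) = prepend a (x ∘ (Y ∘ Z))
    + (prepend b (X ∘ (y ∘ Z)) + prepend c (X ∘ (Y ∘ z))
       + prepend (br b c) (X ∘ (y ∘ z)))
    + (prepend (br a b) (x ∘ (y ∘ Z)) + prepend (br a c) (x ∘ (Y ∘ z))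
       + prepend (br a (br b c)) (x ∘ (y ∘ z))).
  have xYZE := congr1 (fun u => prepend a (x ∘ u)) YZ.
  have {}xYZE := etrans xYZE (linD3 (linear_comp (qr x) (pl a)) _ _ _).
  apply: etrans (congr1 (fun u => u + _ + _) (esym xYZE)).
  apply: etrans (congr1 (qsh_mul br X) YZ) _.
  apply: etrans (linD3 (qr X) _ _ _) _.
  apply: sum9; exact: qsh_prepend.
have rhsE : (X ∘ Y) ∘ Z =
    prepend a ((x ∘ Y) ∘ Z) + prepend b ((X ∘ y) ∘ Z)
      + prepend (br a b) ((x ∘ y) ∘ Z)
    + prepend c ((X ∘ Y) ∘ z)
    + (prepend (br a c) ((x ∘ Y) ∘ z) + prepend (br b c) ((X ∘ y) ∘ z)
       + prepend (br (br a b) c) ((x ∘ y) ∘ z)).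
  have XYzE := congr1 (fun u => prepend c (u ∘ z)) XY.
  have {}XYzE := etrans XYzE (linD3 (linear_comp (ql z) (pl c)) _ _ _).
  apply: etrans (congr1 (fun u => _ + u + _) (esym XYzE)).
  apply: etrans (congr1 (fun u => u ∘ Z) XY) _.
  apply: etrans (linD3 (ql Z) _ _ _) _.
  apply: sum9; exact: qsh_prepend.
have sum7 (V : zmodType) (u1 u2 u3 u4 u5 u6 u7 v1 v2 v3 v4 v5 v6 v7 : V) :
    u1 = v1 -> u2 = v2 -> u3 = v3 -> u4 = v4 -> u5 = v5 -> u6 = v6 ->
    u7 = v7 ->
    u1 + (u2 + u3 + u4) + (u5 + u6 + u7)
      = v1 + v2 + v5 + v3 + (v6 + v4 + v7).
  move=> -> -> -> -> -> -> ->.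
  by rewrite (AC (1*3*3) ((1*2*5)*3*(6*4*7))).
apply: etrans lhsE _; apply: etrans _ (esym rhsE).
(* Each of the seven pairs of terms is matched by one hypothesis; only the last pair also needs the
   two nested brackets to agree. *)
apply: sum7; try by apply: congr1.
by apply: congr2; first exact: brA.
Qed.

(** After reduction to words, the three inductions are nested: an instance with shorter [s] holds
    for all [t] and [u], one with the same [s] and shorter [t] holds for all [u], and only then is
    [u] shortened. The unit laws settle the empty words. *)
Lemma qsh_mulA : associative (qsh_mul br : ncpoly -> ncpoly -> ncpoly).
Proof.
have ql := qsh_linear_l; have qr := qsh_linear_r.
move=> x y z.
pose f1 (x : ncpoly) := x ∘ (y ∘ z); pose g1 (x : ncpoly) := (x ∘ y) ∘ z.
apply: (word_linear_ext (f := f1) (g := g1)) => {x} [||s]; rewrite {}/f1 {}/g1.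
- exact: ql.
- exact: (linear_comp (ql y) (ql z)).
pose f2 (y : ncpoly) := word k s ∘ (y ∘ z).
pose g2 (y : ncpoly) := (word k s ∘ y) ∘ z.
apply: (word_linear_ext (f := f2) (g := g2)) => {y} [||t]; rewrite {}/f2 {}/g2.
- exact: (linear_comp (ql z) (qr _)).
- exact: (linear_comp (qr _) (ql z)).
pose f3 (z : ncpoly) := word k s ∘ (word k t ∘ z).
pose g3 (z : ncpoly) := (word k s ∘ word k t) ∘ z.
apply: (word_linear_ext (f := f3) (g := g3)) => {z} [||u]; rewrite {}/f3 {}/g3.
- exact: (linear_comp (qr _) (qr _)).
- exact: qr.
elim: s t u => [|a s IHs] t u; first by rewrite word_nil !qsh_mul1x.
elim: t u => [|b t IHt] u; first by rewrite word_nil qsh_mul1x qsh_mulx1.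
elim: u => [|c u IHu]; first by rewrite word_nil !qsh_mulx1.
apply: (qsh_mulA_prepend (prepend_word a s) (prepend_word b t)
  (prepend_word c u)).
- exact: IHs.
- exact: IHt.
- exact: IHu.
- exact: IHs.
- exact: IHs.
- exact: IHt.
- exact: IHs.
Qed.

(** * The product on the tensor square and its compatibility with the coproduct *)

Local Notation "s ∙ t" := (tensor_mul (qsh_mul br) s t) (at level 40).
Local Notation ncpoly2 := {malg k[({fmonom A} * {fmonom A})%type]}.

Lemma tensor_qshE (x y x' y' : ncpoly) :
  (x ⊗ y) ∙ (x' ⊗ y') = (x ∘ x') ⊗ (y ∘ y').
Proof. exact: (tensor_mulE _ _ _ _ qsh_bilinear). Qed.

Lemma tensor_qsh_bilinear :
  bilinear_op (tensor_mul (qsh_mul br) : ncpoly2 -> ncpoly2 -> ncpoly2).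
Proof. exact: malg_lift_bilinear. Qed.

Lemma tensor_qsh_linear_r (s : ncpoly2) : linear (tensor_mul (qsh_mul br) s).
Proof. by case: tensor_qsh_bilinear. Qed.

Lemma tensor_qsh_linear_l (t : ncpoly2) : linear (fun s : ncpoly2 => s ∙ t).
Proof. by case: tensor_qsh_bilinear. Qed.

Lemma tprepend_qshE a (x y x' y' : ncpoly) :
  tprepend a ((x ⊗ y) ∙ (x' ⊗ y')) = prepend a (x ∘ x') ⊗ (y ∘ y').
Proof. exact: etrans (congr1 _ (tensor_qshE _ _ _ _)) (tprependE _ _ _). Qed.

(** P_b acts on the first factor, where the multiplier is the unit, so it passes through the
    product. This handles a mixed term in the product of two coproducts. *)
Lemma tensor_qsh_prependr (y : ncpoly) b (t : ncpoly2) :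
  (1 ⊗ y) ∙ tprepend b t = tprepend b ((1 ⊗ y) ∙ t).
Proof.
have tpl : linear (tprepend b) by exact: tensor_map_linear.
have qr := tensor_qsh_linear_r.
move: t; apply: tensor_linear_ext => [||u v].
- exact: (linear_comp tpl (qr _)).
- exact: (linear_comp (qr _) tpl).
apply: etrans (congr1 _ (tprependE b u v)) _.
apply: etrans (tensor_qshE _ _ _ _) (esym (etrans (tprepend_qshE b _ _ _ _) _)).
apply: (congr1 (fun w => w ⊗ _)).
exact: etrans (congr1 _ (qsh_mul1x u)) (esym (qsh_mul1x _)).
Qed.

Lemma tensor_qsh_prependl (y : ncpoly) a (s : ncpoly2) :
  tprepend a s ∙ (1 ⊗ y) = tprepend a (s ∙ (1 ⊗ y)).
Proof.
have tpl : linear (tprepend a) by exact: tensor_map_linear.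
have ql := tensor_qsh_linear_l.
move: s; apply: tensor_linear_ext => [||u v].
- exact: (linear_comp tpl (ql _)).
- exact: (linear_comp (ql _) tpl).
apply: etrans (congr1 (fun w => w ∙ _) (tprependE a u v)) _.
apply: etrans (tensor_qshE _ _ _ _) (esym (etrans (tprepend_qshE a _ _ _ _) _)).
apply: (congr1 (fun w => w ⊗ _)).
exact: etrans (congr1 _ (qsh_mulx1 u)) (esym (qsh_mulx1 _)).
Qed.

(** On pure tensors this is [qsh_prepend] in the first factor, tensored with the common second
    factor y ∘ y'. *)
Lemma tensor_qsh_prepend a b (s t : ncpoly2) :
  tprepend a s ∙ tprepend b t =
    tprepend a (s ∙ tprepend b t) + tprepend b (tprepend a s ∙ t)
    + tprepend (br a b) (s ∙ t).
Proof.
have tpl c : linear (tprepend c) by exact: tensor_map_linear.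
have qr := tensor_qsh_linear_r; have ql := tensor_qsh_linear_l.
move: s; apply: tensor_linear_ext => [||x y].
- exact: (linear_comp (tpl a) (ql _)).
- apply: linear_add; first apply: linear_add.
  + exact: (linear_comp (ql _) (tpl a)).
  + exact: (linear_comp (linear_comp (tpl a) (ql t)) (tpl b)).
  + exact: (linear_comp (ql _) (tpl _)).
move: t; apply: tensor_linear_ext => [||x' y'].
- exact: (linear_comp (tpl b) (qr _)).
- apply: linear_add; first apply: linear_add.
  + exact: (linear_comp (linear_comp (tpl b) (qr _)) (tpl a)).
  + exact: (linear_comp (qr _) (tpl b)).
  + exact: (linear_comp (qr _) (tpl _)).
have Ea := tprependE a x y; have Eb := tprependE b x' y'.
apply: etrans (congr2 (tensor_mul (qsh_mul br)) Ea Eb) _.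
apply: etrans (tensor_qshE _ _ _ _) _.
apply: etrans (congr1 (fun w => w ⊗ (y ∘ y')) (qsh_prepend a b x x')) _.
apply: etrans (linD3 (tensor_linear_l (y ∘ y')) _ _ _) (esym _).
congr (_ + _ + _); last exact: tprepend_qshE.
- apply: etrans (congr1 (fun t => tprepend a ((x ⊗ y) ∙ t)) Eb) _.
  exact: tprepend_qshE.
- apply: etrans (congr1 (fun s => tprepend b (s ∙ (x' ⊗ y'))) Ea) _.
  exact: tprepend_qshE.
Qed.

(** Writing each coproduct as 1 ⊗ P_a x + (P_a ⊗ id)(D x), the product on the right has four pieces:
    1 ⊗ (X ∘ Y), two mixed terms, and a product governed by [tensor_qsh_prepend]. The expansion of D
    (X ∘ Y) regroups into the same pieces. *)
Lemma deconcat_qsh_prepend a b (x y X Y : ncpoly) :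
  prepend a x = X -> prepend b y = Y ->
  deconcat (x ∘ Y) = deconcat x ∙ deconcat Y ->
  deconcat (X ∘ y) = deconcat X ∙ deconcat y ->
  deconcat (x ∘ y) = deconcat x ∙ deconcat y ->
  deconcat (X ∘ Y) = deconcat X ∙ deconcat Y.
Proof.
move=> <- <- {X Y}; set X := prepend a x; set Y := prepend b y => xY Xy xy.
have tpl c : linear (tprepend c) by exact: tensor_map_linear.
have tqr := tensor_qsh_linear_r; have tql := tensor_qsh_linear_l.
have DX : deconcat X = _ := deconcat_prepend a x.
have DY : deconcat Y = _ := deconcat_prepend b y.
(* The [e] terms will add up to 1 ⊗ (X ∘ Y), [p] and [q] are the mixed terms, and the [r] terms form
   the recursion on the tensor square. *)
have sumE (V : zmodType) (u1 u2 u3 e1 e2 e3 p q r1 r2 r3 : V) :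
    u1 = e1 + (q + r1) -> u2 = e2 + (p + r2) -> u3 = e3 + r3 ->
    u1 + u2 + u3 = e1 + e2 + e3 + q + (p + (r1 + r2 + r3)).
  move=> -> -> ->.
  by rewrite (AC ((1*2)*(1*2)*2) (1*4*7*2*(5*(3*6*8)))) /= -!addrA.
apply: etrans (congr1 deconcat (qsh_prepend a b x y)) _.
apply: etrans (linD3 deconcat_linear _ _ _) _.
have L1 : deconcat (prepend a (x ∘ Y)) = 1 ⊗ prepend a (x ∘ Y)
    + (tprepend a (deconcat x) ∙ (1 ⊗ Y)
       + tprepend a (deconcat x ∙ tprepend b (deconcat y))).
  apply: etrans (deconcat_prepend _ _) (congr1 _ _).
  apply: etrans (congr1 _ (etrans xY (congr1 _ DY))) _.
  apply: etrans (congr1 _ (linD (tqr _) _ _)) _.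
  apply: etrans (linD (tpl _) _ _) (congr1 (fun u => u + _) _).
  by apply: esym; apply: tensor_qsh_prependl.
have L2 : deconcat (prepend b (X ∘ y)) = 1 ⊗ prepend b (X ∘ y)
    + ((1 ⊗ X) ∙ tprepend b (deconcat y)
       + tprepend b (tprepend a (deconcat x) ∙ deconcat y)).
  apply: etrans (deconcat_prepend _ _) (congr1 _ _).
  apply: etrans (congr1 _ (etrans Xy (congr1 (fun u => u ∙ _) DX))) _.
  apply: etrans (congr1 _ (linD (tql _) _ _)) _.
  apply: etrans (linD (tpl _) _ _) (congr1 (fun u => u + _) _).
  by apply: esym; apply: tensor_qsh_prependr.
have L3 : deconcat (prepend (br a b) (x ∘ y)) = 1 ⊗ prepend (br a b) (x ∘ y)
    + tprepend (br a b) (deconcat x ∙ deconcat y).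
  exact: etrans (deconcat_prepend _ _) (congr1 _ (congr1 _ xy)).
apply: etrans (sumE _ _ _ _ _ _ _ _ _ _ _ _ L1 L2 L3) (esym _).
apply: etrans (congr2 (tensor_mul (qsh_mul br)) DX DY) _.
apply: etrans (linD (tqr _) _ _) _.
apply: congr2; last first.
  apply: etrans (linD (tql _) _ _) (congr1 _ _).
  exact: tensor_qsh_prepend.
apply: etrans (linD (tql _) _ _) (congr1 (fun u => u + _) _).
apply: etrans (tensor_qshE _ _ _ _) _.
apply: etrans (congr2 _ (qsh_mul1x 1) (qsh_prepend a b x y)) _.
exact: (linD3 (tensor_linear_r 1)).
Qed.

Lemma deconcat_qsh (x y : ncpoly) :
  deconcat (x ∘ y) = deconcat x ∙ deconcat y.
Proof.
have dl := deconcat_linear.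
have qr := qsh_linear_r; have ql := qsh_linear_l.
have tqr := tensor_qsh_linear_r; have tql := tensor_qsh_linear_l.
apply: (word_bilinear_ext (f := fun x y => deconcat (x ∘ y))
  (g := fun x y => deconcat x ∙ deconcat y)) => [||s t].
- split=> z; first exact: (linear_comp (qr _) dl).
  exact: (linear_comp (ql _) dl).
- split=> z; first exact: (linear_comp dl (tqr _)).
  exact: (linear_comp dl (tql _)).
(* The base cases need 1 ⊗ 1, the coproduct of the empty word, to be a two-sided unit of the tensor
   square. *)
have mul1z (z : ncpoly2) : (1 ⊗ 1) ∙ z = z.
  move: z; apply: tensor_linear_ext => [|//|u v]; first exact: tqr.
  exact: etrans (tensor_qshE _ _ _ _) (congr2 _ (qsh_mul1x u) (qsh_mul1x v)).
have mulz1 (z : ncpoly2) : z ∙ (1 ⊗ 1) = z.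
  move: z; apply: tensor_linear_ext => [|//|u v]; first exact: tql.
  exact: etrans (tensor_qshE _ _ _ _) (congr2 _ (qsh_mulx1 u) (qsh_mulx1 v)).
elim: s t => [|a s IHs] t.
  by rewrite word_nil qsh_mul1x deconcat1 mul1z.
elim: t => [|b t IHt]; first by rewrite word_nil qsh_mulx1 deconcat1 mulz1.
exact: (deconcat_qsh_prepend (prepend_word a s) (prepend_word b t)
  (IHs _) IHt (IHs _)).
Qed.

(** For two nonempty words both sides are zero, since all three terms of the recursion lie in the
    image of some P_c; hence no induction is required. *)
Lemma counit_qsh (x y : ncpoly) : counit (x ∘ y) = counit x * counit y.
Proof.
have el := counit_linear; have qr := qsh_linear_r; have ql := qsh_linear_l.
apply: (word_bilinear_ext (U := k^o) (f := fun x y => counit (x ∘ y))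
  (g := fun x y => counit x * counit y)) => [||s t].
- split=> z; first exact: (linear_comp (qr _) el).
  exact: (linear_comp (ql _) el).
- split=> z c u v; rewrite el; last by rewrite mulrDl scalerAl.
  by rewrite mulrDr scalerAr.
case: s => [|a s]; first by rewrite word_nil qsh_mul1x counit1 mul1r.
case: t => [|b t]; first by rewrite word_nil qsh_mulx1 counit1 mulr1.
rewrite -(prepend_word a s) counit_prepend mul0r -(prepend_word b t).
apply: etrans (congr1 _ (qsh_prepend _ _ _ _)) _.
apply: etrans (linD3 el _ _ _) _; have c0 := counit_prepend.
apply: etrans (congr2 +%R (congr2 +%R (c0 _ _) (c0 _ _)) (c0 _ _)) _.
by rewrite !addr0.
Qed.

(** * Assembling the bialgebra axioms *)

Lemma qsh_bialgebra :
  is_bialgebra (qsh_mul (k := k) br) 1 deconcat counit.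
Proof.
split.
- exact: qsh_bilinear.
- exact: qsh_mulA.
- exact: qsh_mul1x.
- exact: qsh_mulx1.
- exact: deconcat_linear.
- exact: counit_linear.
- exact: deconcat_coassoc.
- exact: deconcat_counitl.
- exact: deconcat_counitr.
- exact: deconcat_qsh.
- exact: deconcat1.
- exact: counit_qsh.
- exact: counit1.
Qed.

End Product.

End QuasiShuffle.

Theorem theorem3p1 (R : realType) (S : {pred R[i]}) (k : subFieldType S)
    (A : choiceType) (deg : A -> nat)
    (br : option A -> option A -> option A)
    (hdeg : locally_finite_grading deg) (hbr : is_bracket deg br) :
  is_bialgebra (qsh_mul (k := k) br) (1 : {malg k[{fmonom A}]})
    deconcat counit.
Proof.
apply: qsh_bialgebra.
- exact: br0 hbr.
- exact: brC hbr.
- by move=> x y z; rewrite (brA hbr).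
Qed.
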